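(* Let $k$ be a field and let $R$ be an associative $k$-algebra with identity having countable $k$-vector space dimension. Suppose that $R$ satisfies the ascending chain condition on semiprimitive (two-sided) ideals. Then each subset of $\operatorname{Irr} R$ that is closed under the refined Zariski topology is equal to $V(I) \cup S$ for some semiprimitive ideal $I$ of $R$ and some finite subset $S$ of $\operatorname{Irr} R$. In particular, the refined Zariski topology and the closed-point Zariski topology on $\operatorname{Irr} R$ coincide, and this topology is noetherian.
   Context: ''Ideal'' means two-sided ideal; ''countable'' means finite or countably infinite. An ideal is semiprimitive if it is an intersection of annihilators of simple left $R$-modules (equivalently, $R/I$ has zero Jacobson radical); the empty intersection is allowed, so $R$ itself is a semiprimitive ideal. $\operatorname{Irr} R$ denotes the set of isomorphism classes of simple left $R$-modules, and for $p\in\operatorname{Irr} R$, $N_p$ denotes a chosen simple left $R$-module in the class $p$. Zariski topology on $\operatorname{Irr} R$: the closed sets are the sets $V(I)=\{p\in \operatorname{Irr} R \mid I N_p=0\}$ for ideals $I$ of $R$. Closed-point Zariski topology on $\operatorname{Irr} R$: the coarsest topology in which all one-point sets and all sets $V(I)$ are closed. Refined Zariski topology on $\operatorname{Irr} R$: a subset $X\subseteq \operatorname{Irr} R$ is closed if and only if the isomorphism class of every simple subquotient of the left $R$-module $\prod_{p\in X}N_p$ belongs to $X$. (It is known that these sets are the closed sets of a topology.) The product of an empty family of modules is the zero module. A topology is noetherian if its closed subsets satisfy the descending chain condition. *)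

(* Defs.v *)
From HB Require Import structures.
From mathcomp Require Import all_boot all_order all_algebra.
From mathcomp Require Import all_classical topology.

Set Implicit Arguments.
Unset Strict Implicit.
Unset Printing Implicit Defensive.

Import GRing.Theory.

Local Open Scope classical_set_scope.
Local Open Scope ring_scope.

(* An algebra over k is a ring together with a central ring morphism from k.
   The bundled algType excludes the zero ring, which is allowed here. *)
Definition central_morphism (k R : pzRingType) (iota : {rmorphism k -> R}) :=
  forall (a : k) (x : R), iota a * x = x * iota a.

Definition restrict_scalars (k R : pzRingType) (iota : {rmorphism k -> R}) :
  Type := R.

Section RestrictScalars.
Variables (k R : pzRingType) (iota : {rmorphism k -> R}).

HB.instance Definition _ := GRing.Zmodule.copy (restrict_scalars iota) R.

Let scale (a : k) (x : restrict_scalars iota) : restrict_scalars iota :=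
  iota a * (x : R).

Let scaleA a b x : scale a (scale b x) = scale (a * b) x.
Proof. by rewrite /scale rmorphM mulrA. Qed.
Let scale1 : left_id 1 scale.
Proof. by move=> x; rewrite /scale rmorph1 mul1r. Qed.
Let scaleDr : right_distributive scale +%R.
Proof. by move=> a x y; rewrite /scale mulrDr. Qed.
Let scaleDl x : {morph scale^~ x : a b / a + b}.
Proof. by move=> a b; rewrite /scale rmorphD mulrDl. Qed.

HB.instance Definition _ := GRing.Zmodule_isLmodule.Build k
  (restrict_scalars iota) scaleA scale1 scaleDr scaleDl.
End RestrictScalars.

Section Basis.
Variables (k : fieldType) (V : lmodType k).

Definition linearly_independent (B : set V) :=
  forall (s : seq V) (c : V -> k), uniq s -> (forall v, v \in s -> B v) ->
    \sum_(v <- s) c v *: v = 0 -> forall v, v \in s -> c v = 0.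

Definition spanning (B : set V) :=
  forall x : V, exists (s : seq V) (c : V -> k),
    (forall v, v \in s -> B v) /\ x = \sum_(v <- s) c v *: v.

Definition countable_dim :=
  exists B : set V, [/\ countable B, linearly_independent B & spanning B].
End Basis.

Section Modules.
Variable R : pzRingType.
Implicit Types M N S : lmodType R.

Definition simple_mod M :=
  (exists x : M, x != 0) /\
  forall A : {pred M}, submod_closed A -> A =i pred1 0 \/ A =i predT.

Definition mod_iso M N := exists f : {linear M -> N}, bijective f.

(* S is isomorphic to a quotient of a submodule A of M. *)
Definition subquotient S M :=
  exists (A : lmodType R) (i : {linear A -> M}) (q : {linear A -> S}),
    injective i /\ (forall s, exists a, q a = s).

Definition annihilator M : set R := [set r | forall x : M, r *: x = 0].

Definition two_sided_ideal (I : set R) :=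
  [/\ I 0, forall x y, I x -> I y -> I (x + y),
      forall r x, I x -> I (r * x) & forall r x, I x -> I (x * r)].

(* The family M may be empty, which gives the ideal R. *)
Definition semiprimitive (I : set R) :=
  two_sided_ideal I /\
  exists (J : Type) (M : J -> lmodType R),
    (forall j, simple_mod (M j)) /\ I = \bigcap_j annihilator (M j).

Definition acc_semiprimitive :=
  forall I : nat -> set R, (forall n, semiprimitive (I n)) ->
    (forall n, I n `<=` I n.+1) ->
    exists n, forall m, (n <= m)%N -> I m = I n.

Definition mod_prod (J : Type) (M : J -> lmodType R) : Type := forall j, M j.

(* The isomorphism classes of simple left R-modules, indexed by a type, with a
   chosen simple module in each class.  A direct definition as sets of modules
   would make products over Irr R live in too large a universe. *)
Record irr_reps := IrrReps {
  irr :> Type;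
  irr_mod : irr -> lmodType R;
  irr_simple : forall p, simple_mod (irr_mod p);
  irr_inj : forall p q, mod_iso (irr_mod p) (irr_mod q) -> p = q;
  irr_surj : forall S, simple_mod S -> exists p, mod_iso (irr_mod p) S
}.
End Modules.

Section Product.
Variables (R : pzRingType) (J : Type) (M : J -> lmodType R).
Implicit Types f g h : mod_prod M.

HB.instance Definition _ := gen_eqMixin (mod_prod M).
HB.instance Definition _ := gen_choiceMixin (mod_prod M).

Let prod0 : mod_prod M := fun=> 0.
Let prod_opp f : mod_prod M := fun j => - f j.
Let prod_add f g : mod_prod M := fun j => f j + g j.
Let prod_scale (r : R) f : mod_prod M := fun j => r *: f j.

Let prod_addA : associative prod_add.
Proof. by move=> f g h; apply: functional_extensionality_dep => j; exact: addrA. Qed.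
Let prod_addC : commutative prod_add.
Proof. by move=> f g; apply: functional_extensionality_dep => j; exact: addrC. Qed.
Let prod_add0 : left_id prod0 prod_add.
Proof. by move=> f; apply: functional_extensionality_dep => j; exact: add0r. Qed.
Let prod_addN : left_inverse prod0 prod_opp prod_add.
Proof. by move=> f; apply: functional_extensionality_dep => j; exact: addNr. Qed.

HB.instance Definition _ := GRing.isZmodule.Build (mod_prod M)
  prod_addA prod_addC prod_add0 prod_addN.

Let prod_scaleA r s f : prod_scale r (prod_scale s f) = prod_scale (r * s) f.
Proof. by apply: functional_extensionality_dep => j; exact: scalerA. Qed.
Let prod_scale1 : left_id 1 prod_scale.
Proof. by move=> f; apply: functional_extensionality_dep => j; exact: scale1r. Qed.
Let prod_scaleDr : right_distributive prod_scale +%R.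
Proof. by move=> r f g; apply: functional_extensionality_dep => j; exact: scalerDr. Qed.
Let prod_scaleDl f : {morph prod_scale^~ f : r s / r + s}.
Proof. by move=> r s; apply: functional_extensionality_dep => j; exact: scalerDl. Qed.

HB.instance Definition _ := GRing.Zmodule_isLmodule.Build R (mod_prod M)
  prod_scaleA prod_scale1 prod_scaleDr prod_scaleDl.
End Product.

Section LinearOf.
Variables (R : pzRingType) (U V : lmodType R) (f : U -> V) (hf : linear f).
Definition linear_of : U -> V := let _ := hf in f.
HB.instance Definition _ := GRing.isLinear.Build R U V _ linear_of hf.
End LinearOf.

Section Submodule.
Variables (R : pzRingType) (M : lmodType R) (A : {pred M}).
Hypothesis hA : submod_closed A.

Definition submod_pred : {pred M} := let _ := hA in A.

HB.instance Definition _ := GRing.isSubmodClosed.Build R M submod_pred hA.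

Record submod_type : Type := Submod { submod_val : M; _ : submod_val \in submod_pred }.

HB.instance Definition _ := [isSub for submod_val].
HB.instance Definition _ := [Choice of submod_type by <:].
HB.instance Definition _ := [SubChoice_isSubLmodule of submod_type by <:].
End Submodule.

Lemma subquotientP (R : pzRingType) (S M : lmodType R) :
  subquotient S M <-> exists (A : {pred M}) (f : M -> S),
    [/\ submod_closed A,
        forall r x y, x \in A -> y \in A -> f (r *: x + y) = r *: f x + f y &
        forall s, exists2 x, x \in A & f x = s].
Proof.
split=> [[A [i [q [iinj qsurj]]]]|[A [f [hA flin fsurj]]]].
  pose B : {pred M} := [pred x | `[< exists a, i a = x >]].
  pose f (x : M) : S :=
    if pselect (exists a, i a = x) is left h then q (projT1 (cid h)) else 0.
  have fi a : f (i a) = q a.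
    rewrite /f; case: pselect => [h|]; last by case; exists a.
    by congr (q _); apply: iinj; exact: projT2 (cid h).
  exists B, f; split.
  - split=> [|r x y /asboolP[a <-] /asboolP[b <-]].
      by apply/asboolP; exists 0; rewrite linear0.
    by apply/asboolP; exists (r *: a + b); rewrite linearP.
  - move=> r x y /asboolP[a <-] /asboolP[b <-].
    by rewrite -linearP !fi linearP.
  - move=> s; have [a <-] := qsurj s.
    by exists (i a); rewrite ?fi //; apply/asboolP; exists a.
pose q (a : submod_type hA) : S := f (val a).
have qlin : linear q.
  move=> r x y; rewrite /q linearP flin //; exact: valP.
exists (submod_type hA), (val : {linear _ -> _}), (linear_of qlin : {linear _ -> _}).
split; first exact: val_inj.
by move=> s; have [x xA <-] := fsurj s; exists (Submod (hA := hA) xA).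
Qed.

Lemma subquotient_mono (R : pzRingType) (S M N : lmodType R) (g : {linear M -> N}) :
  injective g -> subquotient S M -> subquotient S N.
Proof.
move=> ginj [A [i [q [iinj qsurj]]]].
by exists A, (g \o i : {linear _ -> _}), q; split=> //; exact: inj_comp.
Qed.

Lemma subquotient_pair (R : pzRingType) (S P Q : lmodType R) :
  simple_mod S -> subquotient S (P * Q)%type ->
  subquotient S P \/ subquotient S Q.
Proof.
move=> [_ Ssimple] /subquotientP[A [f [hA flin fsurj]]].
have [A0 AP] := hA.
have f0 : f 0 = 0.
  by have := flin (-1) 0 0 A0 A0; rewrite !scaleN1r !addNr.
pose B : {pred Q} := [pred y | (0, y) \in A].
have hB : submod_closed B.
  split=> [|r x y Bx By]; first by rewrite inE.
  rewrite inE; have := AP r _ _ Bx By; congr (_ \in A).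
  by congr pair; rewrite /= scaler0 addr0.
pose fB y := f (0, y).
have fBlin r x y : x \in B -> y \in B -> fB (r *: x + y) = r *: fB x + fB y.
  move=> Bx By; rewrite /fB -flin //; congr f.
  by congr pair; rewrite /= scaler0 addr0.
pose C : {pred S} := [pred s | `[< exists2 y, y \in B & fB y = s >]].
have hC : submod_closed C.
  split=> [|r x y /asboolP[u Bu <-] /asboolP[v Bv <-]]; apply/asboolP.
    by exists 0; rewrite // ?(proj1 hB) ?/fB.
  by exists (r *: u + v); [exact: (proj2 hB)|exact: fBlin].
have [C0|CT] := Ssimple _ hC; [left|right]; apply/subquotientP; last first.
  exists B, fB; split=> // s.
  by have := CT s; rewrite !inE => /asboolP[y By <-]; exists y.
have fwd x y y' : (x, y) \in A -> (x, y') \in A -> f (x, y) = f (x, y').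
  move=> Ay Ay'.
  have e : -1 *: (x, y') + (x, y) = (0, y - y').
    by congr pair; rewrite /= scaleN1r ?addNr // addrC.
  have By : y - y' \in B by rewrite inE -e AP.
  have : f (0, y - y') \in C by apply/asboolP; exists (y - y').
  rewrite C0 inE -e flin // scaleN1r addrC subr_eq0 => /eqP //.
pose D : {pred P} := [pred x | `[< exists y, (x, y) \in A >]].
pose g (x : P) : S :=
  if pselect (exists y, (x, y) \in A) is left h then f (x, projT1 (cid h)) else 0.
have gE x y : (x, y) \in A -> g x = f (x, y).
  move=> Ay; rewrite /g; case: pselect => [h|]; last by case; exists y.
  by apply: fwd => //; exact: projT2 (cid h).
exists D, g; split.
- split=> [|r x y /asboolP[u Au] /asboolP[v Av]]; apply/asboolP.
    by exists 0.
  by exists (r *: u + v); exact: (AP r _ _ Au Av).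
- move=> r x y /asboolP[u Au] /asboolP[v Av].
  rewrite (gE _ _ Au) (gE _ _ Av) -flin //; apply: gE.
  exact: (AP r _ _ Au Av).
- move=> s; have [[x y] Axy <-] := fsurj s.
  by exists x; [apply/asboolP; exists y|exact: gE].
Qed.

Section Zariski.
Variables (R : pzRingType) (Irr : irr_reps R).
Implicit Types X Y : set Irr.

Definition zariski_V (I : set R) : set Irr :=
  [set p | I `<=` annihilator (irr_mod p)].

Definition irr_prod X : lmodType R :=
  mod_prod (fun p : {p : Irr | X p} => irr_mod (sval p)).

Definition refined_closed X :=
  forall (S : lmodType R) (p : Irr), simple_mod S ->
    subquotient S (irr_prod X) -> mod_iso (irr_mod p) S -> X p.

Lemma subquotient_irr_prod_sub (S : lmodType R) X Y : X `<=` Y ->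
  subquotient S (irr_prod X) -> subquotient S (irr_prod Y).
Proof.
move=> XY.
pose e (f : irr_prod X) : irr_prod Y := fun q =>
  if pselect (X (sval q)) is left h then f (exist _ (sval q) h) else 0.
have elin : linear e.
  move=> r f g; apply: functional_extensionality_dep => q.
  have -> : (r *: e f + e g) q = r *: e f q + e g q by [].
  by rewrite /e; case: pselect => // _; rewrite scaler0 addr0.
apply: (@subquotient_mono _ _ _ _ (linear_of elin : {linear _ -> _})).
move=> f g efg; apply: functional_extensionality_dep => -[q Xq].
have := congr1 (fun u : irr_prod Y => u (exist _ q (XY _ Xq))) efg.
rewrite /= /linear_of /e /=; case: pselect => // h.
by rewrite (Prop_irrelevance h Xq).
Qed.

Lemma refined_closed0 : refined_closed set0.
Proof.
move=> S p [[x /eqP x0] _] [A [i [q [iinj qsurj]]]] _; case: x0.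
have [a <-] := qsurj x; have -> : a = 0; last exact: linear0.
by apply: iinj; apply: functional_extensionality_dep => -[].
Qed.

Lemma refined_closedU X Y :
  refined_closed X -> refined_closed Y -> refined_closed (X `|` Y).
Proof.
move=> hX hY S p Ssimple SXY pS.
pose e (f : irr_prod (X `|` Y)) : (irr_prod X * irr_prod Y)%type :=
  ((fun q => f (exist _ (sval q) (or_introl (proj2_sig q)))),
   (fun q => f (exist _ (sval q) (or_intror (proj2_sig q))))).
have elin : linear e by move=> r f g.
have einj : injective (linear_of elin).
  move=> f g efg; apply: functional_extensionality_dep => -[q [Xq|Yq]].
    exact: (congr1 (fun u => u.1 (exist _ q Xq)) efg).
  exact: (congr1 (fun u => u.2 (exist _ q Yq)) efg).
have := @subquotient_mono _ _ _ _ (linear_of elin : {linear _ -> _}) einj SXY.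
move=> /(subquotient_pair Ssimple)[sX|sY]; [left; exact: hX sX _|].
by right; exact: hY sY _.
Qed.

Lemma refined_closed_bigcap (J : Type) (X : J -> set Irr) :
  (forall j, refined_closed (X j)) -> refined_closed (\bigcap_j X j).
Proof.
move=> hX S p Ssimple SX pS j _; apply: (hX j S) => //.
by apply: subquotient_irr_prod_sub SX; exact: bigcap_inf.
Qed.

Definition refined_zariski : Type := Irr.

HB.instance Definition _ := gen_eqMixin refined_zariski.
HB.instance Definition _ := gen_choiceMixin refined_zariski.

Definition refined_open : set_system refined_zariski :=
  [set U | refined_closed (~` U)].

Let refined_openT : refined_open setT.
Proof. by rewrite /refined_open /= setCT; exact: refined_closed0. Qed.

Let refined_openI : setI_closed refined_open.
Proof.
by move=> U W hU hW; rewrite /refined_open /= setCI; exact: refined_closedU.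
Qed.

Let refined_open_bigU (J : Type) (f : J -> set refined_zariski) :
  (forall j, refined_open (f j)) -> refined_open (\bigcup_j f j).
Proof.
by move=> hf; rewrite /refined_open /= setC_bigcup; exact: refined_closed_bigcap.
Qed.

HB.instance Definition _ := isOpenTopological.Build refined_zariski
  refined_openT refined_openI refined_open_bigU.

Lemma refined_zariskiP (X : set refined_zariski) : closed X <-> refined_closed X.
Proof. by rewrite -openC /open /= /refined_open /= setCK. Qed.

Definition closed_point_zariski : Type := Irr.

HB.instance Definition _ := gen_eqMixin closed_point_zariski.
HB.instance Definition _ := gen_choiceMixin closed_point_zariski.

Definition closed_point_subbase : set (set closed_point_zariski) :=
  [set U | (exists p, U = ~` [set p]) \/
           (exists I, two_sided_ideal I /\ U = ~` zariski_V I)].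

HB.instance Definition _ := isSubBaseTopological.Build closed_point_zariski
  closed_point_subbase id.

Lemma closed_point_zariski_coarsest (X : set closed_point_zariski) :
  closed X <-> forall C : set (set closed_point_zariski),
    C set0 -> setU_closed C ->
    (forall (J : Type) (f : J -> set closed_point_zariski),
       (forall j, C (f j)) -> C (\bigcap_j f j)) ->
    (forall p, C [set p]) -> (forall I, two_sided_ideal I -> C (zariski_V I)) ->
    C X.
Proof.
split=> [Xcl C C0 CU Ccap C1 CV|]; last first.
  move=> hX; apply: (hX (@closed closed_point_zariski)).
  - exact: closed0.
  - by move=> A B; exact: closedU.
  - by move=> J f hf; apply: closed_bigI.
  - move=> p; rewrite -openC; exists [set ~` [set p]]; last by rewrite bigcup_set1.
    by move=> _ ->; apply: finI_from1; left; exists p.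
  - move=> I hI; rewrite -openC; exists [set ~` zariski_V I]; last by rewrite bigcup_set1.
    by move=> _ ->; apply: finI_from1; right; exists I.
have : open (~` X) by rewrite openC.
move=> [F hF FX]; rewrite -[X]setCK -FX setC_bigcup bigcap_set_type.
apply: Ccap => -[U /= /set_mem FU].
have [E ED <-] := hF _ FU.
rewrite setC_bigcap bigcup_fset big_seq.
elim/big_ind: _ => // U' /ED; rewrite inE => -[[p ->]|[I [hI ->]]].
  by rewrite setCK.
by rewrite setCK; exact: CV.
Qed.
End Zariski.
Arguments zariski_V {R} Irr I.

Section IrrReps.
Variable R : pzRingType.

Lemma mod_iso_sym (M N : lmodType R) : mod_iso M N -> mod_iso N M.
Proof.
move=> [f [g fK gK]].
have glin : linear g by move=> r x y; apply: (can_inj fK); rewrite gK linearP !gK.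
by exists (linear_of glin : {linear _ -> _}); exists f.
Qed.

Lemma mod_iso_trans (N M P : lmodType R) :
  mod_iso M N -> mod_iso N P -> mod_iso M P.
Proof.
move=> [f fbij] [g gbij]; exists (g \o f : {linear _ -> _}); exact: bij_comp.
Qed.

Lemma simple_cyclic (M : lmodType R) (x : M) :
  simple_mod M -> x != 0 -> forall y, exists r, y = r *: x.
Proof.
move=> [_ Msimple] x0 y.
have hA : submod_closed [pred z : M | `[< exists r, z = r *: x >]].
  split=> [|r u v /asboolP[a ->] /asboolP[b ->]]; apply/asboolP.
    by exists 0; rewrite scale0r.
  by exists (r * a + b); rewrite scalerA scalerDl.
have [A0|AT] := Msimple _ hA; last by have := AT y; rewrite !inE => /asboolP.
have := A0 x; rewrite !inE (negbTE x0) => /asboolP[]; exists 1.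
by rewrite scale1r.
Qed.

Lemma simple_mod_iso (M N : lmodType R) (x : M) (y : N) :
  simple_mod M -> simple_mod N -> x != 0 -> y != 0 ->
  [set r | r *: x = 0] = [set r | r *: y = 0] -> mod_iso M N.
Proof.
move=> Ms Ns x0 y0 ann.
have transfer r s : r *: x = s *: x <-> r *: y = s *: y.
  have := congr1 (fun A : set R => A (r - s)) ann => /= e.
  split=> h; apply/eqP; rewrite -subr_eq0 -scalerBl; apply/eqP.
    by rewrite -e scalerBl h subrr.
  by rewrite e scalerBl h subrr.
have [f fE] := choice (simple_cyclic Ms x0).
have [g gE] := choice (simple_cyclic Ns y0).
have flin : linear (fun u => f u *: y).
  move=> r u v; rewrite scalerA -scalerDl; apply/transfer.
  by rewrite -fE scalerDl -scalerA -!fE.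
exists (linear_of flin : {linear _ -> _}); exists (fun v => g v *: x) => u.
  by rewrite [RHS]fE; apply/transfer; rewrite -gE.
by rewrite [RHS]gE; apply/transfer; rewrite -fE.
Qed.

Theorem irr_reps_exist : inhabited (irr_reps R).
Proof.
pose T := {m : set R | exists M : lmodType R, simple_mod M /\
  exists2 x : M, x != 0 & m = [set r | r *: x = 0]}.
pose N (t : T) : lmodType R := projT1 (cid (svalP t)).
have NP (t : T) : simple_mod (N t) /\
    exists2 x : N t, x != 0 & sval t = [set r | r *: x = 0].
  exact: (projT2 (cid (svalP t))).
pose cls t := [set t' : T | mod_iso (N t) (N t')].
pose Irr := {C : set T | exists t, C = cls t}.
pose rep (C : Irr) : T := projT1 (cid (svalP C)).
have repP (C : Irr) : sval C = cls (rep C) by exact: projT2 (cid (svalP C)).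
constructor; apply: (@IrrReps R Irr (fun C => N (rep C))).
- by move=> C; have [] := NP (rep C).
- move=> C D CD.
  suff : sval C = sval D by case: C D {CD} => [? ?] [? ?]; exact: eq_exist.
  rewrite !repP; apply/seteqP; split=> t /= h; last exact: mod_iso_trans h.
  by apply: mod_iso_trans h; exact: mod_iso_sym.
- move=> S Ss; have [[x x0] _] := Ss.
  have hx : exists M : lmodType R, simple_mod M /\
      exists2 y : M, y != 0 & [set r | r *: x = 0] = [set r | r *: y = 0].
    by exists S; split=> //; exists x.
  pose t : T := exist _ _ hx.
  exists (exist _ (cls t) (ex_intro _ t erefl)).
  set C : Irr := exist _ _ _.
  have Ct : mod_iso (N (rep C)) (N t).
    have : sval C t by exists (idfun : {linear _ -> _}); exists id.
    by rewrite repP.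
  apply: mod_iso_trans Ct _; have [Nts [y y0 ye]] := NP t.
  exact: (simple_mod_iso Nts Ss y0 x0 (esym ye)).
Qed.
End IrrReps.

Definition noetherian_topology (T : topologicalType) :=
  forall C : nat -> set T, (forall n, closed (C n)) ->
    (forall n, C n.+1 `<=` C n) ->
    exists n, forall m, (n <= m)%N -> C m = C n.

(* Main.v *)
(** Let [X] be refined closed and let [J] be the ideal of all [r] that kill
    [N_p] for all but finitely many [p] in [X].  By the ascending chain
    condition, [J] is the annihilator of [X \ F] for some finite [F], and it
    stays so when finitely many more points are removed.  As [R] has countable
    dimension, one can then build an element of the product of the [N_p], for
    [p] in [X \ F], whose annihilator is exactly [J].  Hence [R / J] embeds in
    that product, every simple [R / J]-module is a subquotient of it, and
    [X = V(J) U (X /\ F)].  Along a decreasing chain of closed sets [J]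
    increases, so it stabilizes, and the remaining finite parts stabilize. *)
Require Import Defs.
From mathcomp Require Import all_boot all_order all_algebra.
From mathcomp Require Import all_classical topology.

Set Implicit Arguments.
Unset Strict Implicit.
Unset Printing Implicit Defensive.

Import GRing.Theory.

Local Open Scope classical_set_scope.
Local Open Scope ring_scope.

(** * Elements of a product with a prescribed annihilator *)

Lemma mod_prod_update (R : pzRingType) (T : Type) (M : T -> lmodType R)
    (f : mod_prod M) (p : T) (x : M p) :
  exists f' : mod_prod M, f' p = x /\ forall q, q <> p -> f' q = f q.
Proof.
exists (fun q => if pselect (p = q) is left e then eq_rect p M x q e else f q).
split=> [|q qp]; case: pselect => // e; last by case: qp.
by rewrite (Prop_irrelevance e erefl).
Qed.

Section GenericElement.
Variables (k : fieldType) (R : pzRingType) (iota : {rmorphism k -> R}).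

Lemma countable_dim_sequence :
  countable_dim (restrict_scalars iota) ->
  exists b : nat -> R, forall r : R, exists (n : nat) (c : nat -> k),
    r = \sum_(i < n) iota (c i) * b i.
Proof.
move=> [B [/countable_injP[f finj] _ Bspan]].
(* The injection [f] numbers the basis; an index that numbers no basis vector gets 0. *)
pose b (i : nat) : R :=
  if pselect (exists2 v, B v & f v = i) is left h then s2val (cid2 h) else 0.
have bf v : B v -> b (f v) = v.
  move=> Bv; rewrite /b; case: pselect => [h|]; last by case; exists v.
  by case: (cid2 h) => u /= Bu fu; apply: finj; rewrite ?inE.
exists b => r; have [s [c [sB ->]]] := Bspan r.
elim: s sB => [|v s IHs] sB.
  by exists 0%N, (fun=> 0); rewrite big_nil big_ord0.
have [|n [d dE]] := IHs; first by move=> u us; apply: sB; rewrite inE us orbT.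
rewrite big_cons dE; set N := maxn n (f v).+1.
exists N, (fun i => (if i == f v then c v else 0) + (if (i < n)%N then d i else 0)).
under [RHS]eq_bigr do rewrite rmorphD mulrDl.
rewrite big_split /=; congr (_ + _); last first.
  rewrite (big_ord_widen N (fun i => iota (d i) * b i)) ?leq_maxl //.
  rewrite big_mkcond /=; apply: eq_bigr => i _.
  by case: ifP => // _; rewrite rmorph0 mul0r.
have fvN : (f v < N)%N by rewrite leq_max ltnSn orbT.
rewrite (bigD1 (Ordinal fvN)) //= eqxx big1 ?addr0.
  by rewrite bf //; apply: sB; rewrite inE eqxx.
move=> i /eqP ifv; case: eqP => [e|]; last by rewrite rmorph0 mul0r.
by case: ifv; apply: val_inj.
Qed.

(* The values [f p] are chosen one at a time: if some [r] in the span of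
   [b 0, ..., b n] kills the current [f] but is not in [J], then a new
   coordinate not killed by [r] removes all such elements, because modulo [J]
   they are multiples of [r]. *)
Lemma generic_element (T : Type) (M : T -> lmodType R) (J : set R) :
  countable_dim (restrict_scalars iota) ->
  (forall r p (x : M p), J r -> r *: x = 0) ->
  (forall r (F : set T), finite_set F -> ~ J r ->
    exists p, ~ F p /\ exists x : M p, r *: x <> 0) ->
  exists f : mod_prod M, forall r, r *: f = 0 -> J r.
Proof.
move=> /countable_dim_sequence[b bspan] Jkill Jfin.
have J0 : J 0.
  apply: contrapT => /(Jfin _ set0 (finite_set0 _))[p [_ [x]]].
  by rewrite scale0r.
pose V n : set R :=
  [set r | exists c : nat -> k, r = \sum_(i < n) iota (c i) * b i].
pose supp (f : mod_prod M) : set T := [set p | f p <> 0].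
pose good n (f : mod_prod M) :=
  finite_set (supp f) /\ forall r, V n r -> r *: f = 0 -> J r.
have step (nf : nat * mod_prod M) : exists f' : mod_prod M, good nf.1 nf.2 ->
    good nf.1.+1 f' /\ forall p, nf.2 p <> 0 -> f' p = nf.2 p.
  case: nf => n f /=.
  have [[suppf goodf]|] := pselect (good n f); last by exists f.
  have [goodf'|/existsNP[r]] :=
      pselect (forall r, V n.+1 r -> r *: f = 0 -> J r).
    by exists f.
  move=> /not_implyP[[c rE] /not_implyP[rf Jr]].
  have [p [pF [x rx]]] := Jfin _ _ suppf Jr.
  have fp : f p = 0 by apply: contrapT.
  have [f' [f'p f'E]] := mod_prod_update f x.
  exists f' => _; split=> [|q fq]; last first.
    by apply: f'E => qp; apply: fq; rewrite qp.
  split=> [|s [d sE] sf'].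
    apply: (@sub_finite_set _ _ (supp f `|` [set p])).
      move=> q f'q; have [->|qp] := pselect (q = p); first by right.
      by left; rewrite /supp /= -f'E.
    by rewrite finite_setU; split=> //; exact: finite_set1.
  have sf : s *: f = 0.
    apply: functional_extensionality_dep => q.
    have [->|qp] := pselect (q = p).
      by rewrite -[LHS]/(s *: f p) fp scaler0.
    have := congr1 (fun g : mod_prod M => g q) sf'.
    by rewrite -[LHS]/(s *: f' q) f'E.
  have sx : s *: x = 0.
    have := congr1 (fun g : mod_prod M => g p) sf'.
    by rewrite -[LHS]/(s *: f' p) f'p.
  (* Otherwise [r] would lie in [V n] and kill [f], so goodness of [f] would put it in [J]. *)
  have cn : c n != 0.
    apply/eqP => cn; apply: Jr; apply: goodf => //; exists c.
    by rewrite rE big_ord_recr /= cn rmorph0 mul0r addr0.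
  (* This [a] cancels the [b n] term: [s - iota a * r] lies in [V n] and kills [f], hence lies in
     [J]. *)
  pose a := d n / c n.
  have Jt : J (s - iota a * r).
    apply: goodf; last by rewrite scalerBl -scalerA rf sf scaler0 subrr.
    exists (fun i => d i - a * c i).
    rewrite sE rE !big_ord_recr /= mulrDr opprD addrACA mulrA -rmorphM.
    rewrite /a divfK // subrr addr0 mulr_sumr -sumrB; apply: eq_bigr => i _.
    by rewrite -/a rmorphB mulrBl [in RHS]rmorphM mulrA.
  (* Both [s] and [s - iota a * r] kill [x]. As [r *: x] is nonzero, this forces [a = 0], and then
     [s] itself is in [J]. *)
  have : iota a *: (r *: x) = 0.
    have := Jkill _ _ x Jt; rewrite scalerBl sx sub0r scalerA => /eqP.
    by rewrite oppr_eq0 => /eqP.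
  have [a0 _|a0 arx] := eqVneq a 0.
    by move: Jt; rewrite a0 rmorph0 mul0r subr0.
  case: rx; rewrite -[LHS]scale1r -(rmorph1 iota) -(mulVf a0) rmorphM.
  by rewrite -scalerA arx scaler0.
have [next nextP] := choice step.
pose seqf := fix seqf n : mod_prod M :=
  if n is m.+1 then next (m, seqf m) else 0.
have seq_good n : good n (seqf n).
  elim: n => [|n IHn]; last by have [] := nextP (n, seqf n) IHn.
  split=> [|r [c ->] _]; last by rewrite big_ord0.
  by apply: sub_finite_set (finite_set0 T) => p; apply.
have seq_ext n m p : (n <= m)%N -> seqf n p <> 0 -> seqf m p = seqf n p.
  move=> nm np; elim: m nm => [|m IHm]; first by rewrite leqn0 => /eqP ->.
  rewrite leq_eqVlt => /orP[/eqP <- //|]; rewrite ltnS => /IHm mE.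
  by have [_ /(_ p)] := nextP (m, seqf m) (seq_good m); rewrite /= mE => ->.
(* Nonzero values never change along the sequence, so [g] is its pointwise limit, with 0 at
   coordinates that are never filled. *)
pose g : mod_prod M := fun p =>
  if pselect (exists n, seqf n p <> 0) is left h
  then seqf (sval (cid h)) p else 0.
have gE n p : seqf n p <> 0 -> g p = seqf n p.
  move=> np; rewrite /g; case: pselect => [h|]; last by case; exists n.
  case: (cid h) => m mp /=.
  by have [/seq_ext->|/ltnW/seq_ext->] := leqP m n.
(* Every [r] lies in some [V n], and [g] agrees with [seqf n] on the support of [seqf n], so [r]
   kills [seqf n] too. *)
exists g => r rg; have [n [c rE]] := bspan r.
apply: (proj2 (seq_good n)); first by exists c.
apply: functional_extensionality_dep => p; rewrite -[LHS]/(r *: seqf n p).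
have [->|np] := pselect (seqf n p = 0); first exact: scaler0.
by have := congr1 (fun h : mod_prod M => h p) rg; rewrite -(gE _ _ np).
Qed.
End GenericElement.

(** * Subquotients and annihilators *)

Section Annihilators.
Variable R : pzRingType.

(** The rule [r *: f] to [r *: x] is well defined on the cyclic submodule generated by [f], and it
    maps onto [S]. *)
Lemma subquotient_annihilator (S M : lmodType R) (x : S) (f : M) :
  (forall y, exists r, y = r *: x) -> (forall r, r *: f = 0 -> r *: x = 0) ->
  subquotient S M.
Proof.
move=> xgen fx; apply/subquotientP.
pose A : {pred M} := [pred z | `[< exists r, z = r *: f >]].
pose h (z : M) : S :=
  if pselect (exists r, z = r *: f) is left e then sval (cid e) *: x else 0.
have hE r : h (r *: f) = r *: x.
  rewrite /h; case: pselect => [e|]; last by case; exists r.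
  case: (cid e) => s /= rs; apply/eqP; rewrite -subr_eq0 -scalerBl; apply/eqP.
  by apply: fx; rewrite scalerBl -rs subrr.
exists A, h; split.
- split=> [|r u v /asboolP[a ->] /asboolP[c ->]]; apply/asboolP.
    by exists 0; rewrite scale0r.
  by exists (r * a + c); rewrite scalerA scalerDl.
- move=> r u v /asboolP[a ->] /asboolP[c ->].
  by rewrite scalerA -scalerDl !hE scalerDl scalerA.
- move=> s; have [r ->] := xgen s; exists (r *: f); rewrite ?hE //.
  by apply/asboolP; exists r.
Qed.

Lemma subquotient_killed (S M : lmodType R) :
  subquotient S M -> annihilator M `<=` annihilator S.
Proof.
move=> [A [i [q [iinj qsurj]]]] r rM s; have [a <-] := qsurj s.
rewrite -linearZZ (_ : r *: a = 0) ?linear0 //; apply: iinj.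
by rewrite linearZZ linear0 rM.
Qed.

Lemma two_sided_bigcap_annihilator (J : Type) (M : J -> lmodType R) :
  two_sided_ideal (\bigcap_j annihilator (M j)).
Proof.
split.
- by move=> j _ x; rewrite scale0r.
- by move=> r s hr hs j _ x; rewrite scalerDl hr // hs // addr0.
- by move=> r s hs j _ x; rewrite -scalerA hs // scaler0.
- by move=> r s hs j _ x; rewrite -scalerA hs.
Qed.

Lemma mod_iso_annihilator (M N : lmodType R) :
  mod_iso M N -> annihilator N `<=` annihilator M.
Proof.
by move=> [f [g fK _]] r rN x; apply: (can_inj fK); rewrite linearZZ linear0 rN.
Qed.

(** Since [S] is nonzero, the image of [i] is not 0, hence all of [M], and the kernel of [q] is
    proper, hence 0. Thus both maps are bijective. *)
Lemma subquotient_simple (S M : lmodType R) :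
  simple_mod S -> simple_mod M -> subquotient S M -> mod_iso M S.
Proof.
move=> Ss [_ Ms] [A [i [q [iinj qsurj]]]].
have imA : submod_closed [pred z : M | `[< exists a, i a = z >]].
  split=> [|r u v /asboolP[a <-] /asboolP[c <-]]; apply/asboolP.
    by exists 0; rewrite linear0.
  by exists (r *: a + c); rewrite linearP.
have [[s s0] Ssimple] := Ss.
have [A0|AT] := Ms _ imA.
  have [a qa] := qsurj s; case/eqP: s0; rewrite -qa.
  suff -> : a = 0 by rewrite linear0.
  apply: iinj; rewrite linear0; have := A0 (i a); rewrite !inE.
  by move=> e; apply/eqP; rewrite -e; apply/asboolP; exists a.
have isurj z : exists a, i a = z by have := AT z; rewrite !inE => /asboolP.
have qinj : injective q.
  (* The kernel of [q], carried into [M] by [i], so that simplicity of [M] applies. *)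
  have kerq : submod_closed [pred z : M | `[< exists2 a, i a = z & q a = 0 >]].
    split=> [|r u v /asboolP[a <- qa] /asboolP[c <- qc]]; apply/asboolP.
      by exists 0; rewrite linear0.
    by exists (r *: a + c); rewrite linearP // qa qc scaler0 addr0.
  have [K0|KT] := Ms _ kerq.
    move=> a c ac; apply/eqP; rewrite -subr_eq0; apply/eqP; apply: iinj.
    rewrite linear0; have := K0 (i (a - c)); rewrite !inE => e.
    apply/eqP; rewrite -e; apply/asboolP; exists (a - c) => //.
    by rewrite linearB ac subrr.
  have [a qa] := qsurj s; case/eqP: s0; rewrite -qa.
  by have := KT (i a); rewrite !inE => /asboolP[c /iinj <-].
have [j jE] := choice isurj.
have jlin : linear (q \o j).
  move=> r u v /=; rewrite -linearP; congr (q _); apply: iinj.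
  by rewrite linearP !jE.
have [l lE] := choice qsurj.
exists (linear_of jlin : {linear _ -> _}); exists (i \o l) => u /=.
  by rewrite -[RHS]jE; congr (i _); apply: qinj; rewrite lE.
by rewrite /linear_of /= -[RHS]lE; congr (q _); apply: iinj; rewrite jE.
Qed.
End Annihilators.

(** * Annihilators up to finitely many points *)

Section EssentialAnnihilator.
Variables (R : pzRingType) (Irr : irr_reps R).
Implicit Types (X Y F : set Irr).

Definition set_annihilator X : set R :=
  \bigcap_(p in X) annihilator (irr_mod p).

(** The ideal [J] of the overview, as the union of a directed family of semiprimitive ideals. *)
Definition essential_annihilator X : set R :=
  [set r | exists2 F, finite_set F & set_annihilator (X `\` F) r].

Lemma semiprimitive_set_annihilator X : semiprimitive (set_annihilator X).
Proof.
rewrite /set_annihilator bigcap_set_type.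
split; first exact: two_sided_bigcap_annihilator.
exists {p : Irr | p \in X}, (fun p => irr_mod (val p)); split=> // p.
exact: irr_simple.
Qed.

Lemma set_annihilatorS X Y :
  X `<=` Y -> set_annihilator Y `<=` set_annihilator X.
Proof. by move=> XY r rY p /XY; exact: rY. Qed.

Lemma essential_annihilatorS X Y :
  X `<=` Y -> essential_annihilator Y `<=` essential_annihilator X.
Proof.
move=> XY r [F Ffin rF]; exists F => //.
by apply: set_annihilatorS rF; exact: setSD.
Qed.

Hypothesis R_acc : acc_semiprimitive R.

(** If no finite [F] sufficed, each could be enlarged so that the annihilator grows strictly, which
    gives an infinite ascending chain of semiprimitive ideals. *)
Lemma essential_annihilatorE X :
  exists2 F, finite_set F & essential_annihilator X = set_annihilator (X `\` F).
Proof.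
apply: contrapT => noF.
pose T := {F : set Irr | finite_set F}.
have step (F : T) : exists F' : T, sval F `<=` sval F' /\
    exists2 r, set_annihilator (X `\` sval F') r &
               ~ set_annihilator (X `\` sval F) r.
  case: F => F Ffin /=.
  have : ~ (essential_annihilator X `<=` set_annihilator (X `\` F)).
    move=> sub; apply: noF; exists F => //; apply/seteqP; split=> // r rF.
    by exists F.
  move=> /existsNP[r /not_implyP[[G Gfin rG] rF]].
  have FGfin : finite_set (F `|` G) by rewrite finite_setU.
  exists (exist _ (F `|` G) FGfin) => /=; split; first by move=> p; left.
  exists r => //; apply: set_annihilatorS rG.
  by move=> p [Xp FGp]; split=> // Gp; apply: FGp; right.
have [next nextP] := choice step.
pose F n : T := iter n next (exist _ set0 (finite_set0 _)).
have [n|n|n nE] := R_acc (I := fun n => set_annihilator (X `\` sval (F n))).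
- exact: semiprimitive_set_annihilator.
- by apply: set_annihilatorS; apply: setDS; have [] := nextP (F n).
- have [_ [r rS]] := nextP (F n); apply.
  by rewrite -(nE n.+1).
Qed.

Lemma semiprimitive_essential_annihilator X :
  semiprimitive (essential_annihilator X).
Proof.
by have [F _ ->] := essential_annihilatorE X; exact: semiprimitive_set_annihilator.
Qed.

(** * Comparison of the two topologies *)

Lemma refined_closed_V I : refined_closed (zariski_V Irr I).
Proof.
move=> S p Ss SV pS r Ir; apply: (mod_iso_annihilator pS).
apply: (subquotient_killed SV) => f.
by apply: functional_extensionality_dep => -[q Vq]; exact: Vq.
Qed.

(** A product over one point embeds in [irr_mod p], whose only simple subquotient up to isomorphism
    is itself. *)
Lemma refined_closed1 (p : Irr) : refined_closed [set p].
Proof.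
move=> S p' Ss Sp pS; apply: irr_inj; apply: mod_iso_trans pS _.
apply: mod_iso_sym; apply: subquotient_simple => //; first exact: irr_simple.
pose e (f : irr_prod [set p]) : irr_mod p := f (exist _ p erefl).
have elin : linear e by [].
apply: (@subquotient_mono _ _ _ _ (linear_of elin : {linear _ -> _})) Sp.
move=> f g fg; apply: functional_extensionality_dep => -[q h].
have qp : q = p := h; subst q.
by rewrite (Prop_irrelevance h erefl).
Qed.

(** The closed-point topology is the coarsest one with the required closed sets, so it is enough
    that the refined topology has them. *)
Lemma closed_point_closed_refined X :
  closed (X : set (closed_point_zariski Irr)) -> refined_closed X.
Proof.
move=> /closed_point_zariski_coarsest; apply.
- exact: refined_closed0.
- exact: refined_closedU.
- exact: refined_closed_bigcap.
- exact: refined_closed1.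
- by move=> I _; exact: refined_closed_V.
Qed.

Lemma zariski_V_closed I : two_sided_ideal I ->
  closed (zariski_V Irr I : set (closed_point_zariski Irr)).
Proof. by move=> Iideal; apply/closed_point_zariski_coarsest => C _ _ _ _; apply. Qed.

Lemma finite_closed X : finite_set X ->
  closed (X : set (closed_point_zariski Irr)).
Proof.
move=> Xfin; apply/closed_point_zariski_coarsest => C C0 CU _ C1 _.
have /finite_seqP[s ->] : finite_set (X : set (closed_point_zariski Irr)) by [].
elim: s => [|p s IHs]; first by rewrite set_nil.
suff -> : [set` p :: s] = [set p] `|` [set` s] by exact: CU.
by apply/seteqP; split=> q /=; rewrite inE => /predU1P.
Qed.

(** * Decomposition and descending chains in countable dimension *)

Variables (k : fieldType) (iota : {rmorphism k -> R}).
Hypothesis R_dim : countable_dim (restrict_scalars iota).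

Lemma refined_closedE X : refined_closed X ->
  exists2 F, finite_set F & X = zariski_V Irr (essential_annihilator X) `|` F.
Proof.
move=> Xcl; have [F Ffin JE] := essential_annihilatorE X.
exists (X `&` F); first by apply: sub_finite_set Ffin; exact: subIsetr.
apply/seteqP; split=> [p Xp|p [Vp|[]//]].
  have [Fp|Fp] := pselect (F p); first by right.
  by left; rewrite JE => r; apply.
have [f fP] : exists f : irr_prod (X `\` F),
    forall r, r *: f = 0 -> essential_annihilator X r.
  apply: (generic_element R_dim) => [r [q /= XFq] x|r G Gfin Jr].
    by rewrite JE => /(_ q XFq); apply.
  (* If [r] killed all components outside [G], it would kill all points of [X] outside [F] and the
     finite image of [G], and so be in the essential annihilator. *)
  apply: contrapT => noq; apply: Jr; exists (F `|` [set sval q | q in G]).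
    by rewrite finite_setU; split=> //; exact: finite_image.
  move=> q [Xq FGq] x; apply: contrapT => rx; apply: noq.
  have XFq : (X `\` F) q by split=> // Fq; apply: FGq; left.
  exists (exist _ q XFq); split; last by exists x.
  by move=> Gq; apply: FGq; right; exists (exist _ q XFq).
(* What kills [f] lies in the essential annihilator, which kills [irr_mod p]; so this simple module
   is a subquotient of the product, and closedness of [X] gives [p]. *)
have ps := irr_simple p; have [[x x0] _] := ps.
apply: (Xcl _ _ ps); last by exists (idfun : {linear _ -> _}); exists id.
apply: (@subquotient_irr_prod_sub _ _ _ (X `\` F)); first by move=> q [].
apply: (@subquotient_annihilator _ _ _ x f); first exact: simple_cyclic.
by move=> r /fP /Vp; apply.
Qed.

Lemma refined_closed_dcc (C : nat -> set Irr) :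
  (forall n, refined_closed (C n)) -> (forall n, C n.+1 `<=` C n) ->
  exists n, forall m, (n <= m)%N -> C m = C n.
Proof.
move=> Ccl Cdec.
have Cmono n m : (n <= m)%N -> C m `<=` C n.
  move=> /subnK <-; elim: (m - n)%N => // d IHd p; rewrite addSn => /Cdec.
  exact: IHd.
have [n|n|N NE] := R_acc (I := fun n => essential_annihilator (C n)).
- exact: semiprimitive_essential_annihilator.
- by apply: essential_annihilatorS.
(* From [N] on the ideals agree, so all later sets contain the same [V] part and only points of the
   finite part can still leave. *)
have VC m : (N <= m)%N -> zariski_V Irr (essential_annihilator (C N)) `<=` C m.
  move=> Nm; have [F _ CmE] := refined_closedE (Ccl m).
  by rewrite -(NE m Nm) [X in _ `<=` X]CmE; left.
have [F Ffin CNE] := refined_closedE (Ccl N).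
have /finite_seqP[s sE] : finite_set (F : set (refined_zariski Irr)) by [].
(* An index at which [p] has already left the chain; 0 serves for points that never leave. *)
have exit (p : refined_zariski Irr) : exists n, (exists m, ~ C m p) -> ~ C n p.
  by have [[n np]|] := pselect (exists m, ~ C m p); [exists n|exists 0%N].
have [h hP] := choice exit.
(* Past this bound the ideals are stable and each point of the finite part that ever leaves has
   left. *)
exists (maxn N (\max_(p <- s) h p)) => m; rewrite geq_max => /andP[Nm sm].
apply/seteqP; split=> p.
  by apply: Cmono; rewrite geq_max Nm.
move=> Cp; have := Cmono N _ (leq_maxl _ _) _ Cp.
rewrite [X in X p]CNE => -[/(VC m Nm)//|].
rewrite sE /= => ps; apply: contrapT => mp.
apply: (hP p (ex_intro _ m mp)); apply: Cmono Cp.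
by rewrite leq_max (@leq_bigmax_seq _ s xpredT h p ps) ?orbT.
Qed.
End EssentialAnnihilator.

Theorem theorem3p2 (k : fieldType) (R : pzRingType)
    (iota : {rmorphism k -> R}) (iota_central : central_morphism iota)
    (R_dim : countable_dim (restrict_scalars iota))
    (R_acc : acc_semiprimitive R)
    (Irr : irr_reps R) :
  [/\ forall X : set (refined_zariski Irr), closed X ->
        exists (I : set R) (S : set Irr),
          [/\ semiprimitive I, finite_set S & X = zariski_V Irr I `|` S],
      forall X : set Irr,
        closed (X : set (refined_zariski Irr)) <->
        closed (X : set (closed_point_zariski Irr))
    & noetherian_topology (refined_zariski Irr)].
Proof.
have decomp (X : set Irr) : refined_closed X -> exists (I : set R) (S : set Irr),
    [/\ semiprimitive I, finite_set S & X = zariski_V Irr I `|` S].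
  move=> Xcl; have [S Sfin XE] := refined_closedE R_acc R_dim Xcl.
  exists (essential_annihilator X), S; split=> //.
  exact: semiprimitive_essential_annihilator.
split=> [X /refined_zariskiP/decomp //|X|C Ccl Cdec].
(* The decomposition writes a refined closed set as a union of two sets closed in the closed-point
   topology. *)
- split=> [/refined_zariskiP/decomp[I [S [[Iideal _] Sfin ->]]]|Xcl].
    by apply: closedU; [exact: zariski_V_closed|exact: finite_closed].
  by apply/refined_zariskiP; exact: closed_point_closed_refined.
- apply: (refined_closed_dcc R_acc R_dim) Cdec => n.
  by apply/refined_zariskiP; exact: Ccl.
Qed.
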